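(* There is an absolute constant $C>0$ such that the following holds. Let $G=(n,s,\{u^p_i\})$ be an anonymous game with $n\ge 2$ players and $s\ge 2$ strategies, with utilities in $[0,1]$, and let $\lambda>0$ be such that $|u^p_i(x)-u^p_i(y)|\le \lambda\|x-y\|_1$ for all $p\in[n]$, $i\in[s]$ and $x,y\in\Pi^s_{n-1}$. Then $G$ has an $\epsilon$-approximate pure Nash equilibrium with $\epsilon = C s^2\lambda$.
   Context: An anonymous game $G=(n,s,\{u^p_i\})$ consists of players $[n]=\{1,\dots,n\}$, strategies $[s]=\{1,\dots,s\}$, and for each $p\in[n]$, $i\in[s]$ a utility function $u^p_i:\Pi^s_{n-1}\to[0,1]$, where $\Pi^s_{n-1}=\{(x_1,\dots,x_s)\in\mathbb{Z}_{\ge 0}^s:\sum_i x_i=n-1\}$; $u^p_i(x)$ is the utility of player $p$ playing strategy $i$ when, for each $\ell$, exactly $x_\ell$ of the other $n-1$ players play strategy $\ell$. A pure strategy profile is a map $S:[n]\to[s]$; for $p\in[n]$, $x[S,p]\in\Pi^s_{n-1}$ is the vector whose $\ell$-th entry is the number of $q\in[n]\setminus\{p\}$ with $S(q)=\ell$. $S$ is an $\epsilon$-approximate pure Nash equilibrium if for all $p\in[n]$ and all $i\in[s]$, $u^p_{S(p)}(x[S,p])+\epsilon\ge u^p_i(x[S,p])$. *)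

(* Defs.v *)
From HB Require Import structures.
From mathcomp Require Import all_boot all_order all_algebra.
Set Implicit Arguments. Unset Strict Implicit. Unset Printing Implicit Defensive.
Import Order.TTheory GRing.Theory Num.Theory.
Local Open Scope ring_scope.

Definition inPi (n s : nat) (x : {ffun 'I_s -> nat}) : bool :=
  (\sum_(l < s) x l)%N == n.-1.

Definition l1dist (R : numDomainType) (s : nat) (x y : {ffun 'I_s -> nat}) : R :=
  \sum_(l < s) `|(x l)%:R - (y l)%:R|.

Definition others (n s : nat) (S : {ffun 'I_n -> 'I_s}) (p : 'I_n)
  : {ffun 'I_s -> nat} :=
  [ffun l => #|[set q : 'I_n | (q != p) && (S q == l)]|].

(* epsilon-approximate pure Nash equilibrium of the anonymous game with
   utilities u p i : Pi^s_{n-1} -> R (given as functions on all of N^s;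
   only their values on Pi^s_{n-1} matter) *)
Definition approx_PNE (R : numDomainType) (n s : nat)
  (u : 'I_n -> 'I_s -> {ffun 'I_s -> nat} -> R)
  (S : {ffun 'I_n -> 'I_s}) (eps : R) : Prop :=
  forall (p : 'I_n) (i : 'I_s),
    u p i (others S p) <= u p (S p) (others S p) + eps.

(* Main.v *)
(* Refine the simplex of strategy counts to the grid of points y in N^s of
   total s n (n - 1), whose unit is 1/(s n) of a player.  Player p reads y
   through a rounding to a point of Pi^s_{n-1} that is shifted by p, and best
   responds to what it reads.  Because of the shifts only about s players
   change their view when y moves by O(s) in the fine grid, so the resulting
   pure profile varies continuously with y, and no mixed strategy or purification
   is needed.  A Sperner-type lemma, applied to the colouring of y by a strategy
   whose load is at least the share prescribed by y, gives a y at which every load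
   is at least the prescribed share up to O(s).  As the totals agree, the profile
   is at l1-distance O(s^2) from what each player reads.
   The Sperner-type lemma is Scarf's: it concerns finite families of linear
   orders and needs no triangulation. *)
Require Import Defs.
From HB Require Import structures.
From mathcomp Require Import all_boot all_order all_algebra.
From mathcomp Require Import zify lra.
Set Implicit Arguments. Unset Strict Implicit. Unset Printing Implicit Defensive.
Import Order.TTheory GRing.Theory Num.Theory.

(** Exactly one collision occurs: dropping either of two colliding elements keeps the image, which
    then has as many elements as its source. *)
Lemma near_injective (aT rT : finType) (f : aT -> rT) (A : {set aT}) :
  #|f @: A|.+1 = #|A| ->
  exists a1 a2, [/\ a1 \in A, a2 \in A, a1 != a2, f a1 = f a2 &
    {in A :\ a1 &, injective f} /\ {in A :\ a2 &, injective f}].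
Proof.
move=> fA.
have /dinjectivePn [a1 a1A [a2 /andP[/= a21 a2A] f12]] : ~~ dinjectiveb f (mem A).
  apply/negP => /dinjectiveP fI.
  by have := card_in_imset fI; rewrite -fA => /eqP; rewrite eqn_leq ltnn andbF.
have inj b b' : b \in A -> b' \in A -> b' != b -> f b = f b' ->
    {in A :\ b &, injective f}.
  move=> bA b'A b'b fbb'; apply/imset_injP.
  have -> : f @: (A :\ b) = f @: A.
    apply/eqP; rewrite eqEsubset imsetS ?subsetDl //=.
    apply/subsetP => _ /imsetP[z zA ->]; have [->|zb] := eqVneq z b.
      by rewrite fbb' imset_f // !inE b'b.
    by rewrite imset_f // !inE zb.
  by have := cardsD1 b A; rewrite bA -fA => -[->].
exists a1, a2; split=> //; first by rewrite eq_sym.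
by split; [apply: inj f12 | apply: inj (esym f12); rewrite 1?eq_sym].
Qed.

(** * Scarf's lemma *)

Section Scarf.
Variables (T I : finType) (r : I -> T -> nat).

(** These sets replace the simplices of a triangulation: for nonempty [B], no point exceeds the
    minima of [B] in all orders at once. *)
Definition dominant (B : {set T}) :=
  [forall y, [exists j, [forall (b | b \in B), r j y <= r j b]]].

Lemma dominantP (B : {set T}) :
  reflect (forall y, exists j, forall b, b \in B -> r j y <= r j b) (dominant B).
Proof.
by apply: (iffP forallP) => H y; have := H y;
  [move/existsP => [j /forall_inP]; exists j |
   move=> [j ?]; apply/existsP; exists j; apply/forall_inP].
Qed.

Lemma dominantS (B D : {set T}) : D \subset B -> dominant B -> dominant D.
Proof.
move=> /subsetP DB /dominantP dB; apply/dominantP => y.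
by have [j jP] := dB y; exists j => b /DB; apply: jP.
Qed.

Definition last_above (above : {set T}) j : {set T} :=
  [set x in above | [forall (y | y \in above), r j y <= r j x]].

Hypothesis rI : forall i, injective (r i).

Lemma card_last_above (Y : {set T}) j : #|last_above Y j| = (Y != set0).
Proof.
have [->|[y0 y0Y]] := set_0Vmem Y.
  by rewrite eqxx; apply/eqP; rewrite cards_eq0; apply/eqP/setP => x; rewrite !inE.
have -> : Y != set0 by apply/set0Pn; exists y0.
case: (arg_maxnP (r j) y0Y) => x xY xmax.
apply/eqP/cards1P; exists x; apply/setP => z; rewrite !inE.
apply/andP/eqP => [[zY /forall_inP zmax]|->].
  by apply: (@rI j); apply/eqP; rewrite eqn_leq zmax // andbT; apply: xmax.
by split=> //; apply/forall_inP.
Qed.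

(* Scarf's replacement step: as [low] maps [I] onto [D], which has one element
   less, exactly one pair j1, j2 shares its minimum; an element can be added to [D]
   only by becoming the minimum for j1 or for j2, while being as high as possible
   in that order among the elements above the other minima. *)
Section Door.
Variables (D : {set T}) (low : I -> T).
Hypotheses (domD : dominant D) (cardD : #|D|.+1 = #|I|).
Hypothesis lowD : forall j, low j \in D.
Hypothesis low_min : forall j d, d \in D -> r j (low j) <= r j d.

Definition above j := [set y | [forall (k | k != j), r k (low k) < r k y]].

Lemma aboveP j y : reflect (forall k, k != j -> r k (low k) < r k y) (y \in above j).
Proof. by rewrite inE; apply: forall_inP. Qed.

Lemma lowE j d : d \in D -> (forall d', d' \in D -> r j d <= r j d') -> low j = d.
Proof.
by move=> dD dmin; apply: (@rI j); apply/eqP; rewrite eqn_leq low_min // dmin.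
Qed.

Lemma above_low j x : x \in above j -> r j x <= r j (low j).
Proof.
move=> /aboveP xj; have /dominantP/(_ x)[k kP] := domD.
have [<-|/xj] := eqVneq k j; first exact: kP.
by rewrite ltnNge kP.
Qed.

Lemma door_rooms : exists j1 j2, [/\ j1 != j2, low j1 = low j2,
  #|[set x | x \notin D & dominant (x |: D)]| =
    (above j1 != set0) + (above j2 != set0) &
  forall j k, j != k -> low j = low k -> pred2 j1 j2 j].
Proof.
have Dlow : low @: [set: I] = D.
  apply/setP => d; apply/imsetP/idP => [[j _ ->] //|dD].
  by have /dominantP/(_ d)[j jP] := domD; exists j; rewrite // (lowE dD).
have [|j1 [j2 [_ _ j12 low12 [inj1 inj2]]]] := @near_injective _ _ low [set: I].
  by rewrite Dlow cardsT.
have pairP j k : j != k -> low j = low k -> pred2 j1 j2 j.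
  move=> jk ljk; apply/norP => -[/= j1' j2'].
  have [kj1|kj1] := eqVneq k j1; last first.
    by case/eqP: jk; apply: inj1; rewrite ?inE ?j1' ?kj1.
  by case/eqP: jk; apply: inj2; rewrite ?inE ?j2' // kj1 j12.
exists j1, j2; split=> //.
have lowN j d : pred2 j1 j2 j -> d \in D -> exists2 k, k != j & low k = d.
  rewrite -{1}Dlow => /orP[] /eqP-> /imsetP[k _ ->].
    by have [->|] := eqVneq k j1; [exists j2; rewrite // eq_sym | exists k].
  by have [->|] := eqVneq k j2; [exists j1 | exists k].
have lastP j x : pred2 j1 j2 j -> x \in last_above (above j) j ->
    (x \notin D) && dominant (x |: D).
  move=> j12' /setIdP[xj /forall_inP xmax]; apply/andP; split.
    apply/negP => xD; have [k kj lk] := lowN j x j12' xD.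
    by have /aboveP/(_ k kj) := xj; rewrite lk ltnn.
  apply/dominantP => y.
  have [yj|] := boolP (y \in above j).
    exists j => b /setU1P[->|bD]; first exact: xmax.
    by apply: leq_trans (xmax y yj) (leq_trans (above_low xj) (low_min _ bD)).
  rewrite inE => /forall_inPn[k kj]; rewrite -leqNgt => yk.
  exists k => b /setU1P[->|bD]; last exact: leq_trans yk (low_min _ bD).
  by apply: leq_trans yk (ltnW _); have /aboveP -> := xj.
have -> : [set x | x \notin D & dominant (x |: D)] =
    last_above (above j1) j1 :|: last_above (above j2) j2.
  apply/setP => x; rewrite in_setU [LHS]inE.
  apply/andP/orP => [[xD domx]|]; last first.
    by move=> [] xl; apply/andP; [apply: (lastP j1)|apply: (lastP j2)];
      rewrite /= ?eqxx ?orbT // inE.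
  have /dominantP dx := domx.
  have [j jP] := dx x.
  have xj d : d \in D -> r j x < r j d.
    move=> dD; rewrite ltn_neqAle jP ?inE ?dD ?orbT // andbT.
    by apply: contra xD => /eqP /rI ->.
  (* As [x] has displaced [low j] in order [j], the order witnessing dominance at [low j] is another
     one; so [low j] is a repeated minimum and [j] belongs to the pair. *)
  have [l lP] := dx (low j).
  have lj : l != j.
    apply: contraTneq (lP x (setU11 _ _)) => ->.
    by rewrite -ltnNge xj.
  have ll : low l = low j.
    by apply: lowE => // d dD; apply: lP; rewrite inE dD orbT.
  have j12' : pred2 j1 j2 j by apply: pairP (esym ll); rewrite eq_sym.
  have xabove : x \in above j.
    apply/aboveP => k kj; rewrite ltnNge; apply/negP => xk.
    (* If [x] were also the minimum for [k], the elements of [D] would be minima for the remaining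
       orders only, which are one too few. *)
    have : D \subset low @: ~: [set j; k].
      apply/subsetP => d dD; have [m mP] := dx d.
      have md : low m = d by apply: lowE => // d' d'D; apply: mP; rewrite inE d'D orbT.
      rewrite -md imset_f // !inE; apply/norP; split.
        by apply: contraTneq (mP x (setU11 _ _)) => ->; rewrite -ltnNge xj.
      apply: contraNneq xD => mk; rewrite mk in md mP.
      suff -> : x = d by [].
      by apply: (@rI k); apply/eqP; rewrite eqn_leq mP ?setU11 // -md xk.
    move/subset_leq_card/leq_trans/(_ (leq_imset_card _ _)).
    by rewrite -ltnS cardD -(cardsC [set j; k]) cards2 eq_sym kj add2n ltnn.
  have xl : x \in last_above (above j) j.
    rewrite inE xabove; apply/forall_inP => y yj; have [k kP] := dx y.
    have [<-|kj] := eqVneq k j; first by apply: kP; rewrite setU11.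
    have /aboveP/(_ k kj) := yj; rewrite ltnNge kP //.
    by rewrite inE lowD orbT.
  by case/orP: j12' xl => /eqP->; [left|right].
rewrite cardsU !card_last_above.
suff -> : last_above (above j1) j1 :&: last_above (above j2) j2 = set0.
  by rewrite cards0 subn0.
apply/setP => x; rewrite [in RHS]inE; apply/negP => /setIP[/setIdP[x1 _] /setIdP[x2 _]].
have := above_low x2; apply/negP; rewrite -ltnNge.
by have /aboveP -> := x1; rewrite // eq_sym.
Qed.
End Door.

(* The slack elements [e i] stand for the facets of the simplex. *)
Variables (e : I -> T) (c : T -> I).
Hypothesis e_min : forall i x, x != e i -> r i (e i) < r i x.
Hypothesis e_above : forall i j x, i != j -> x \notin codom e -> r i x < r i (e j).
Hypothesis c_e : forall i, c (e i) = i.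
Variables (x0 : T) (i0 : I).
Hypothesis x0P : x0 \notin codom e.
Hypothesis I_gt1 : 1 < #|I|.

Definition rooms (D : {set T}) := [set x | x \notin D & dominant (x |: D)].

Let D0 := e @: ~: [set i0].

(** A door other than [D0] contains a non-slack element, so slack elements witness that both sets
    [above] are nonempty: two rooms. For [D0] the repeated minimum is shared by [i0] and some [k0],
    and only the side of [i0] is open. *)
Lemma odd_card_rooms (D : {set T}) :
  dominant D -> #|D|.+1 = #|I| -> c @: D = ~: [set i0] ->
  odd #|rooms D| = (D == D0).
Proof.
move=> domD cardD cD.
have [d0 d0D] : exists d0, d0 \in D.
  by apply/set0Pn; rewrite -card_gt0 -ltnS cardD.
pose low j := [arg min_(d < d0 in D) r j d].
have lowD j : low j \in D by rewrite /low; case: arg_minnP.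
have low_min j d : d \in D -> r j (low j) <= r j d.
  by rewrite /low; case: arg_minnP => // d' _; apply.
have [j1 [j2 [j12 low12 -> pairP]]] := door_rooms domD cardD lowD low_min.
have [DD0|DD0] := eqVneq D D0; last first.
  have [d dD de] : exists2 d, d \in D & d \notin codom e.
    apply/subsetPn; apply: contra DD0 => /subsetP De.
    have cI : {in D &, injective c}.
      by apply/imset_injP; rewrite cD cardsC1 -cardD.
    rewrite eqEcard; apply/andP; split; last first.
      by rewrite (leq_trans (leq_imset_card _ _)) // cardsC1 -cardD.
    apply/subsetP => d dD; have /codomP[i di] := De d dD; rewrite di imset_f //.
    by rewrite -cD -(c_e i) -di imset_f.
  have ne j : above low j != set0.
    apply/set0Pn; exists (e j); apply/aboveP => k kj.
    exact: leq_ltn_trans (low_min k d dD) (e_above kj de).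
  by rewrite !ne.
have eD k : (e k \in D) = (k != i0).
  rewrite DD0; apply/imsetP/idP => [[k' + /(congr1 c)]|ki].
    by rewrite !c_e !inE => ? ->.
  by exists k; rewrite // !inE.
have low_e k : k != i0 -> low k = e k.
  move=> ki; apply: (lowE lowD low_min); first by rewrite eD.
  by move=> d _; have [->|/e_min/ltnW] := eqVneq d (e k).
have [k0 k0i lowi] : exists2 k, k != i0 & low i0 = e k.
  by have := lowD i0; rewrite {1}DD0 => /imsetP[k]; rewrite !inE; exists k.
have ne_i0 : above low i0 != set0.
  apply/set0Pn; exists x0; apply/aboveP => k ki; rewrite low_e //.
  by apply: e_min; apply: contraNneq x0P => ->; apply: codom_f.
(* Such a [y] would lie above [e k0] in order [i0], hence be a slack [e l] with [l] neither [i0] nor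
   [k0]; but [e l] is the bottom of order [l]. *)
have empty_k0 : above low k0 == set0.
  apply/set0Pn => -[y /aboveP yP].
  have := yP i0; rewrite eq_sym k0i lowi => /(_ isT) yi.
  have /codomP[l yl] : y \in codom e.
    apply: contraLR yi => ye; rewrite -leqNgt ltnW // e_above // eq_sym //.
  have li : l != i0.
    by apply: contraTneq yi => li; rewrite yl li -leqNgt ltnW // e_min //
      (inj_eq (can_inj c_e)).
  have lk : l != k0 by apply: contraTneq yi => lk; rewrite yl lk ltnn.
  by have := yP l lk; rewrite low_e // yl ltnn.
have [i12 k12] : pred2 j1 j2 i0 /\ pred2 j1 j2 k0.
  by split; [apply: (pairP i0 k0)|apply: (pairP k0 i0)];
    rewrite ?lowi ?(low_e k0) // eq_sym.
by case/orP: i12 k12 => /eqP<- /orP[] /eqP k0E; move: k0i ne_i0 empty_k0;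
  rewrite k0E ?eqxx // => _ -> ->.
Qed.

Lemma dominant_D0 : dominant D0.
Proof.
apply/dominantP => y; have [/codomP[i ->]|ye] := boolP (y \in codom e).
  by exists i => b _; have [->|/e_min/ltnW] := eqVneq b (e i).
by exists i0 => _ /imsetP[k + ->]; rewrite !inE eq_sym => ki; rewrite ltnW ?e_above.
Qed.

Lemma card_D0 : #|D0|.+1 = #|I|.
Proof. by rewrite card_imset ?cardsC1 ?prednK ?(ltnW I_gt1) //; apply: can_inj c_e. Qed.

Lemma c_D0 : c @: D0 = ~: [set i0].
Proof. by rewrite -imset_comp (eq_imset _ c_e) imset_id. Qed.

(** If there is a door at all, [B] has every colour but [i0] and repeats just one; removing either
    of the two elements of that colour gives a door. *)
Lemma even_card_doors (B : {set T}) : #|B| = #|I| -> c @: B != setT ->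
  ~~ odd #|[set b in B | c @: (B :\ b) == ~: [set i0]]|.
Proof.
move=> cardB cB.
have [->|[b]] := set_0Vmem [set b in B | c @: (B :\ b) == ~: [set i0]].
  by rewrite cards0.
rewrite inE => /andP[bB /eqP cBb].
have cBE : c @: B = ~: [set i0].
  apply/eqP; rewrite eq_sym eqEsubset -{1}cBb imsetS ?subsetDl //=.
  apply/subsetP => _ /imsetP[z zB ->]; rewrite !inE; apply: contra cB => /eqP ci.
  apply/eqP/setP => i; rewrite inE; have [->|ii] := eqVneq i i0.
    by rewrite -ci imset_f.
  have : i \in c @: (B :\ b) by rewrite cBb !inE.
  by apply/subsetP; rewrite imsetS ?subsetDl.
have [|a1 [a2 [a1B a2B a12 c12 [inj1 inj2]]]] := @near_injective _ _ c B.
  by rewrite cBE cardB cardsC1 prednK ?(ltnW I_gt1).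
suff -> : [set b in B | c @: (B :\ b) == ~: [set i0]] = [set a1; a2].
  by rewrite cards2 a12.
apply/setP => a; rewrite !inE; apply/andP/orP => [[aB /eqP ca]|]; last first.
  move=> aE; have aB : a \in B by case: aE => /eqP->.
  split=> //; rewrite -cBE eqEsubset imsetS ?subsetDl //=.
  apply/subsetP => _ /imsetP[z zB ->]; have [->|za] := eqVneq z a.
    by case: aE => /eqP->; [rewrite c12|rewrite -c12];
      rewrite imset_f // !inE ?a2B ?a1B ?andbT // eq_sym.
  by rewrite imset_f // !inE za.
have : c a \in c @: (B :\ a) by rewrite ca -cBE imset_f.
case/imsetP => z; rewrite !inE => /andP[za zB] caz.
apply/orP/norP => -[aa1 aa2].
have [za1|za1] := eqVneq z a1.
  by case/eqP: za; rewrite za1; apply: inj2; rewrite // ?inE ?a12 ?aa2 // -za1.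
by case/eqP: za; apply: inj1; rewrite // ?inE ?za1 ?aa1.
Qed.

(* Double counting, modulo 2, of the pairs of a dominant set [B] of full size and
   an element whose removal leaves exactly the colours other than [i0]: grouped by
   [B], the pairs come in even groups unless [B] is colourful, and grouped by what
   remains, in even groups with the exception of [D0]. *)
Lemma colourful_dominant : exists B, dominant B /\ c @: B = setT.
Proof.
suff /existsP[B /andP[domB /eqP cB]] : [exists B, dominant B && (c @: B == setT)].
  by exists B.
apply: contraT; rewrite negb_exists => /forallP nocol.
pose W := [set w : {set T} * T | [&& w.2 \in w.1, #|w.1| == #|I|, dominant w.1
  & c @: (w.1 :\ w.2) == ~: [set i0]]].
have even_W : ~~ odd #|W|.
  rewrite -sum1_card (partition_big (fun w => w.1) xpredT) //=.
  elim/big_ind: _ => // [m n|B _]; first by rewrite oddD => /negbTE-> /negbTE->.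
  have [/andP[/eqP cardB domB]|nB] := boolP ((#|B| == #|I|) && dominant B); last first.
    rewrite big_pred0 // => -[B' b]; rewrite !inE /=.
    by apply/andP => -[/and4P[_ ? ?] _ /eqP BB]; case/negP: nB; rewrite -BB; apply/andP.
  have cB : c @: B != setT by have := nocol B; rewrite domB.
  have := even_card_doors cardB cB; congr (~~ odd _).
  rewrite -(card_imset _ (fun b1 b2 (H : (B, b1) = (B, b2)) => congr1 snd H)) -sum1_card.
  apply: eq_bigl => -[B' b] /=; rewrite [in RHS]inE /=.
  apply/imsetP/andP => [[b' + [-> ->]]|].
    by rewrite inE cardB domB !eqxx => /andP[-> ->].
  by case=> /and4P[/= bB _ _ cb] /eqP <-; exists b; rewrite // inE bB.
case/negP: even_W.
rewrite -sum1_card (partition_big (fun w => w.1 :\ w.2) xpredT) //=.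
have fib D : odd (\sum_(w in W | w.1 :\ w.2 == D) 1) = (D == D0).
  have [/and3P[domD /eqP cardD /eqP cD]|nD] :=
      boolP [&& dominant D, #|D|.+1 == #|I| & c @: D == ~: [set i0]]; last first.
    rewrite big_pred0 => [|[B b]]; last first.
      rewrite !inE /=; apply/andP => -[/and4P[bB /eqP cardB domB cB] /eqP BD].
      case/negP: nD; rewrite -BD cB -cardB (cardsD1 b B) bB eqxx andbT.
      by rewrite (dominantS _ domB) ?subsetDl.
    apply/esym/eqP => DE; case/negP: nD.
    by rewrite DE dominant_D0 card_D0 c_D0 !eqxx.
  rewrite -odd_card_rooms //; congr odd.
  rewrite -(card_imset _ (fun b1 b2 (H : (b1 |: D, b1) = (b2 |: D, b2)) => congr1 snd H)).
  rewrite -sum1_card.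
  apply: eq_bigl => -[B b] /=; rewrite inE /=.
  apply/andP/imsetP => [[/and4P[bB /eqP cardB domB cB] /eqP BD]|].
    by exists b; rewrite ?inE -BD ?setD1K // !inE eqxx.
  case=> b' + [-> ->]; rewrite inE => /andP[bD domB].
  by rewrite setU1K // setU11 cardsU1 bD add1n cardD cD domB !eqxx.
rewrite (bigD1 D0) //= oddD fib eqxx.
suff /negbTE-> : ~~ odd (\sum_(D | D != D0) \sum_(w in W | w.1 :\ w.2 == D) 1) by [].
elim/big_ind: _ => // [m n|D DD0]; first by rewrite oddD => /negbTE-> /negbTE->.
by rewrite fib.
Qed.
End Scarf.

(** * Sperner's lemma on the lattice points of a simplex *)

Section LatticeSperner.
Variables (s M : nat) (c : {ffun 'I_s -> nat} -> 'I_s).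
Hypothesis s_gt1 : 1 < s.

Let X := {y : {ffun 'I_s -> 'I_M.+1} | \sum_i (y i : nat) == M}.
Let T := (X + 'I_s)%type.

(** Coordinate [i] with ties broken by enumeration; division by the number of points recovers the
    coordinate. *)
Definition lattice_code (x : X) (i : 'I_s) : nat := val x i * #|{: X}| + enum_rank x.

Definition lattice_bound : nat := M.+1 * #|{: X}|.

(** Slack [i] is the bottom of order [i]; the other slacks lie above all lattice points. *)
Definition lattice_rank (i : 'I_s) (t : T) : nat :=
  match t with
  | inl x => (lattice_code x i).+1
  | inr j => if i == j then 0 else lattice_bound.+1 + j
  end.

Definition lattice_colour (t : T) : 'I_s :=
  match t with inl x => c [ffun i => val x i : nat] | inr j => j end.

Lemma lattice_code_lt (x : X) (i : 'I_s) : lattice_code x i < lattice_bound.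
Proof.
apply: (@leq_trans ((val x i).+1 * #|{: X}|)); last by rewrite leq_mul2r ltn_ord orbT.
by rewrite /lattice_code mulSn addnC ltn_add2r.
Qed.

Lemma lattice_rank_inj i : injective (lattice_rank i).
Proof.
move=> [x|j] [y|k] /=.
- move=> [E]; congr inl; apply: enum_rank_inj; apply: val_inj => /=.
  by move/(congr1 (modn^~ #|{: X}|)): E; rewrite !modnMDl !modn_small.
- by have := lattice_code_lt x i; case: eqP => // _; lia.
- by have := lattice_code_lt y i; case: eqP => // _; lia.
- case: eqP => [<-|_]; case: eqP => [<-|_] // E; congr inr; apply: val_inj => /=; lia.
Qed.

(** Take a colourful dominant set; [m j] is its least [j]-th coordinate, or 0 if it contains slack
    [j], which replaces a boundary condition. Were the sum of [m] at most [M - s], all non-slack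
    bounds could be raised by one below a common lattice point, against dominance. *)
Lemma lattice_sperner : exists (y : {ffun 'I_s -> nat}) (m : 'I_s -> nat),
  [/\ \sum_i y i = M, forall j, m j <= y j, M < \sum_i m i + s &
   forall j, m j = 0 \/ exists z : {ffun 'I_s -> nat},
     [/\ \sum_i z i = M, forall k, m k <= z k & c z = j]].
Proof.
have i0 : 'I_s by apply: (@Ordinal s 0); apply: ltnW.
have pointP (t : 'I_s -> nat) j1 : \sum_i t i <= M ->
    exists x : X, forall i, val x i = t i + (i == j1) * (M - \sum_i t i) :> nat.
  move=> tM; pose x := [ffun i => inord (t i + (i == j1) * (M - \sum_i t i)) : 'I_M.+1].
  have xE i : x i = t i + (i == j1) * (M - \sum_i t i) :> nat.
    rewrite ffunE inordK // ltnS; have : t i <= \sum_i t i by rewrite (bigD1 i) //= leq_addr.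
    by case: (i == j1); lia.
  have xP : \sum_i (x i : nat) == M.
    rewrite (eq_bigr _ (fun i _ => xE i)) big_split /=.
    rewrite [X in _ + X](bigD1 j1) //= eqxx [X in _ + (_ + X)]big1 => [|i /negbTE->] //.
    by rewrite mul1n addn0 subnKC.
  by exists (exist _ x xP).
have [x0 _] : exists x0 : X, True.
  by have [|x _] := @pointP (fun=> 0) i0; [rewrite big1 | exists x].
have [|||||B [/dominantP domB cB]] :=
    @colourful_dominant T _ lattice_rank lattice_rank_inj inr lattice_colour _ _ _ (inl x0) i0.
- move=> i [x|j] xi /=; rewrite eqxx //.
  by case: eqP => // ij; rewrite ij eqxx in xi.
- move=> i j [x|k] /negbTE ij; last by rewrite codom_f.
  by move=> _ /=; rewrite ij; have := lattice_code_lt x i; lia.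
- by [].
- by apply/codomP => -[].
- by rewrite card_ord.
have noslack j : inr j \notin B -> exists2 a : X, inl a \in B & lattice_colour (inl a) = j.
  have : j \in lattice_colour @: B by rewrite cB.
  by case/imsetP => -[a|j'] bB -> jB; [exists a | rewrite bB in jB].
have domX (y : X) : exists2 j, inr j \notin B &
    forall a : X, inl a \in B -> val y j <= val a j.
  have [j jP] := domB (inl y); exists j.
    by apply/negP => /jP /=; rewrite eqxx.
  move=> a /jP /=; rewrite ltnS => /(leq_div2r #|{: X}|).
  have X_gt0 : 0 < #|{: X}| by apply/card_gt0P; exists a.
  by rewrite /lattice_code !divnMDl // !divn_small ?addn0.
(* Some slack is missing, so its colour comes from a lattice point [a0], the default for the minima
   below. *)
have [j1 j1B _] := domX x0; have [a0 a0B _] := noslack _ j1B.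
pose low j := [arg min_(a < a0 | inl a \in B) val a j].
pose m j : nat := if inr j \in B then 0 else val (low j) j.
have lowB j : inl (low j) \in B by rewrite /low; case: arg_minnP.
have m_le (a : X) j : inl a \in B -> m j <= val a j.
  by rewrite /m; case: ifP => // _; rewrite /low; case: arg_minnP => // b _; apply.
pose vec (x : X) := [ffun i => val x i : nat].
have vecM x : \sum_i vec x i = M.
  by rewrite -(eqP (valP x)); apply: eq_bigr => i _; rewrite ffunE.
exists (vec a0), m; split=> // [j||j].
- by rewrite ffunE m_le.
- rewrite ltnNge; apply/negP => mM.
  pose t j := if inr j \in B then 0 else (m j).+1.
  have tM : \sum_i t i <= M.
    apply: leq_trans mM; rewrite -[X in _ + X]card_ord -sum1_card -big_split /=.
    by apply: leq_sum => i _; rewrite /t; case: ifP => _; lia.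
  have [y yE] := @pointP t j1 tM.
  have [j /[dup] jB /negbTE jB' /(_ _ (lowB j))] := domX y.
  by rewrite yE {1}/t jB' /m jB' => /(leq_trans (leq_addr _ _)); rewrite ltnn.
- have [jB|/noslack[a aB aj]] := boolP (inr j \in B); first by left; rewrite /m jB.
  right; exists (vec a); split=> // k.
  by rewrite ffunE m_le.
Qed.
End LatticeSperner.

(** * Rounding and best responses *)

(** Hermite's identity. The sums for [a] and [a.+1] arise from one sum of [n.+1] terms by dropping
    its last or its first term. *)
Lemma hermite_sum (n a : nat) : 0 < n -> \sum_(p < n) (a + p) %/ n = a.
Proof.
move=> n0; elim: a => [|a IH].
  by rewrite big1 // => p _; rewrite add0n divn_small.
have : \sum_(p < n.+1) (a + p) %/ n = a + (a %/ n).+1.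
  by rewrite big_ord_recr /= IH divnDr // divnn n0 addn1.
rewrite big_ord_recl /= addn0 [RHS]addnS -addSn [RHS]addnC => /addnI E.
by rewrite -[RHS]E; apply: eq_bigr => p _; rewrite /bump /= addSnnS.
Qed.

(** Each disagreement contributes at least one to the difference of the two Hermite sums. *)
Lemma card_div_shift_neq (n a b : nat) : 0 < n -> a <= b ->
  #|[set p : 'I_n | (a + p) %/ n != (b + p) %/ n]| <= b - a.
Proof.
move=> n0 ab; rewrite leq_subRL //.
rewrite -[leqRHS](hermite_sum b n0) -[X in X + _](hermite_sum a n0).
rewrite cardsE -sum1_card [X in _ + X]big_mkcond -big_split /=.
apply: leq_sum => p _; rewrite unfold_in.
have : (a + p) %/ n <= (b + p) %/ n by rewrite leq_div2r // leq_add2r.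
by case: eqP => [->|] /=; lia.
Qed.

Section View.
Variables (n s : nat).
Implicit Types (y z : 'I_s -> nat) (p : 'I_n).

Definition prefix_sum y k : nat := \sum_(i < s | i < k) y i.

(* Rounding prefix sums instead of coordinates makes the rounded coordinates
   add up to the exact total [n.-1]; the last prefix sum is a multiple of the unit. *)
Definition cut p y k : nat := (prefix_sum y k %/ s + p) %/ n.

Definition view p y : {ffun 'I_s -> nat} := [ffun i : 'I_s => cut p y i.+1 - cut p y i].

Lemma prefix_sumS y (i : 'I_s) : prefix_sum y i.+1 = prefix_sum y i + y i.
Proof.
rewrite /prefix_sum (bigD1 i) ?ltnSn //= addnC; congr (_ + _).
by apply: eq_bigl => j; rewrite ltnS ltn_neqAle andbC.
Qed.

Lemma prefix_sum_all y : prefix_sum y s = \sum_i y i.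
Proof. by apply: eq_bigl => i; rewrite ltn_ord. Qed.

Lemma prefix_sum0 y : prefix_sum y 0 = 0.
Proof. exact: big_pred0. Qed.

Lemma leq_prefix_sum y k l : k <= l -> prefix_sum y k <= prefix_sum y l.
Proof.
move=> kl; rewrite /prefix_sum [leqRHS]big_mkcond [leqLHS]big_mkcond.
by apply: leq_sum => i _; case: ifP => // ik; rewrite (leq_trans ik kl).
Qed.

Hypothesis s_gt0 : 0 < s.
Hypothesis n_gt0 : 0 < n.

Lemma view_inPi p y : \sum_i y i = s * (n * n.-1) -> inPi n (view p y).
Proof.
move=> yM; rewrite /inPi.
have -> : \sum_(l < s) view p y l = \sum_(0 <= l < s) (cut p y l.+1 - cut p y l).
  by rewrite big_mkord; apply: eq_bigr => i _; rewrite ffunE.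
rewrite telescope_sumn => [|k l kl]; last first.
  by rewrite leq_div2r // leq_add2r leq_div2r // leq_prefix_sum.
rewrite /cut prefix_sum_all yM prefix_sum0 div0n add0n mulKn //.
by rewrite mulnC divnMDl // divn_small // addn0 subn0.
Qed.

(** There is no rounding loss: adding [s * (n * t)] to a prefix sum raises its cut by exactly
    [t]. *)
Lemma view_le p y j t : y j <= s * (n * t) -> view p y j <= t.
Proof.
move=> yt; rewrite ffunE leq_subLR /cut prefix_sumS.
rewrite [leqRHS]addnC -divnMDl // leq_div2r // addnA leq_add2r.
by rewrite -divnMDl // leq_div2r // addnC leq_add2r mulnC [t * n]mulnC.
Qed.

Section Cell.
Variable m : 'I_s -> nat.
Let M := s * (n * n.-1).
Hypothesis mM : M < \sum_i m i + s.

Definition in_cell y := \sum_i y i = M /\ forall i, m i <= y i.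

Lemma in_cell_lt y j : in_cell y -> y j < m j + s.
Proof.
move=> [yM my]; move: mM; rewrite -yM (bigD1 j) //= [X in _ < X + _](bigD1 j) //=.
have : \sum_(i < s | i != j) m i <= \sum_(i < s | i != j) y i by apply: leq_sum.
move=> le_my lt_ym; rewrite -(ltn_add2r (\sum_(i < s | i != j) y i)).
by apply: leq_trans lt_ym _; rewrite addnAC leq_add2l.
Qed.

(** Both prefix sums lie between that of [m] and [M] minus the rest of [m], an interval shorter than
    [s]. *)
Lemma in_cell_prefix_lt y z k : in_cell y -> in_cell z ->
  prefix_sum y k < prefix_sum z k + s.
Proof.
move=> [yM my] [zM mz].
have : prefix_sum m k <= prefix_sum z k by apply: leq_sum.
have : prefix_sum y k + \sum_(i < s | ~~ (i < k)) m i <= M.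
  by rewrite -yM [leqRHS](bigID (fun i : 'I_s => i < k)) /= leq_add2l leq_sum.
have := mM; rewrite (bigID (fun i : 'I_s => i < k)) /= -/(prefix_sum m k); lia.
Qed.

(** After division by [s] the prefix sums differ by at most one, and a unit move changes the shifted
    rounding of at most one player. *)
Lemma card_cut_neq y z k : in_cell y -> in_cell z ->
  #|[set p : 'I_n | cut p y k != cut p z k]| <= 1.
Proof.
wlog yz : y z / prefix_sum y k <= prefix_sum z k => [W yc zc|yc zc].
  have [yz|/ltnW zy] := leqP (prefix_sum y k) (prefix_sum z k); first exact: W.
  by under eq_finset => p do rewrite eq_sym; apply: W.
apply: leq_trans (card_div_shift_neq n_gt0 (leq_div2r s yz)) _.
rewrite leq_subLR -(_ : (prefix_sum y k + s) %/ s = prefix_sum y k %/ s + 1); last first.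
  by rewrite divnDr // divnn s_gt0.
by rewrite leq_div2r // ltnW // in_cell_prefix_lt.
Qed.

Lemma card_view_neq y z : in_cell y -> in_cell z ->
  #|[set p : 'I_n | view p y != view p z]| <= s.+1.
Proof.
move=> yc zc.
have /subset_leq_card/leq_trans : [set p : 'I_n | view p y != view p z] \subset
    \bigcup_(k < s.+1) [set p : 'I_n | cut p y k != cut p z k].
  apply/subsetP => p; rewrite inE; apply: contraR => /bigcupP pk.
  apply/eqP/ffunP => i; rewrite !ffunE.
  have ck k : k < s.+1 -> cut p y k = cut p z k.
    move=> ks; apply/eqP/negPn/negP => pn; case: pk.
    by exists (Ordinal ks); rewrite // inE.
  by rewrite !ck // ?ltnS // ltnW.
apply; rewrite -[leqRHS]card_ord -[leqRHS]sum1_card.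
elim/big_rec2: _ => [|k S t _ tS]; first by rewrite cards0.
rewrite cardsU (leq_trans (leq_subr _ _)) // leq_add //.
exact: card_cut_neq.
Qed.
End Cell.
End View.

Section Response.
Variables (n s : nat) (best : 'I_n -> {ffun 'I_s -> nat} -> 'I_s).
Hypotheses (n_gt0 : 0 < n) (s_gt1 : 1 < s).

Definition response (y : 'I_s -> nat) : {ffun 'I_n -> 'I_s} := [ffun p => best p (view p y)].

Implicit Types (S : {ffun 'I_n -> 'I_s}) (p : 'I_n).

Definition load S j := #|[set p | S p == j]|.

Lemma sum_load S : \sum_j load S j = n.
Proof.
rewrite -[RHS]card_ord -sum1_card (partition_big S xpredT) //=.
by apply: eq_bigr => j _; rewrite /load -sum1_card; apply: eq_bigl => p; rewrite inE.
Qed.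

Lemma sum_others S p : \sum_j others S p j = n.-1.
Proof.
have := cardsC1 p; rewrite card_ord => <-.
rewrite -sum1_card (partition_big S xpredT) //=.
apply: eq_bigr => j _; rewrite ffunE -sum1_card.
by apply: eq_bigl => q; rewrite !inE.
Qed.

Lemma load_le_others S p j : load S j <= (others S p j).+1.
Proof.
rewrite ffunE /load (cardsD1 p) -add1n leq_add ?leq_b1 //.
by apply/subset_leq_card/subsetP => q; rewrite !inE.
Qed.

Let s_gt0 : 0 < s := ltnW s_gt1.

(** For each [j] with nonzero [m j], a point [z] of the cell has colour [j], so [z j] is covered by
    its own load. Passing from [z] to [y] changes at most [s.+1] views, and one further unit absorbs
    [y j < z j + s]. *)
Lemma exists_balanced : exists y : {ffun 'I_s -> nat},
  \sum_i y i = s * (n * n.-1) /\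
  forall j, y j <= s * (n * (load (response y) j + s.+2)).
Proof.
pose M := s * (n * n.-1).
pose i0 := Ordinal s_gt0.
pose colour (y : {ffun 'I_s -> nat}) :=
  odflt i0 [pick j | y j <= s * (n * load (response y) j)].
(* Such a colour exists because the loads add up to [n] but the prescribed
   shares only to [n.-1]. *)
have colourP (y : {ffun 'I_s -> nat}) : \sum_i y i = M ->
    y (colour y) <= s * (n * load (response y) (colour y)).
  move=> yM; rewrite /colour; case: pickP => //= no.
  suff : M < M by rewrite ltnn.
  have : \sum_j s * (n * load (response y) j) <= \sum_j y j.
    by apply: leq_sum => j _; rewrite ltnW // ltnNge no.
  rewrite -!big_distrr /= sum_load yM; apply: leq_trans.
  by rewrite /M !ltn_pmul2l // prednK.
have [y [m [yM my mM mz]]] := lattice_sperner M colour s_gt1.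
have yc : in_cell n m y by [].
exists y; split=> // j.
have yj := in_cell_lt mM j yc.
have [mj|[z [zM mzk zj]]] := mz j; first by nia.
have zc : in_cell n m z by [].
have : z j <= s * (n * load (response z) j) by rewrite -zj colourP.
have : load (response z) j <= load (response y) j + s.+1.
  apply: leq_trans (leq_add (leqnn _) (card_view_neq s_gt0 n_gt0 mM yc zc)).
  rewrite /load; apply: leq_trans (leq_card_setU _ _).
  apply/subset_leq_card/subsetP => p; rewrite !inE !ffunE => /eqP <-.
  by have [->|] := eqVneq (view p y) (view p z); rewrite ?eqxx ?orbT.
have := mzk j; nia.
Qed.

Lemma view_le_others : exists S : {ffun 'I_n -> 'I_s}, forall p,
  exists v : {ffun 'I_s -> nat}, [/\ inPi n v, S p = best p v &
    forall j, v j <= others S p j + s.+3].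
Proof.
have [y [yM yP]] := exists_balanced.
exists (response y) => p; exists (view p y); split=> [||j].
- exact: view_inPi.
- by rewrite ffunE.
- apply: leq_trans (view_le s_gt0 n_gt0 p (yP j)) _.
  by rewrite [leqRHS]addnS -addSn leq_add2r load_le_others.
Qed.
End Response.

(** * From one-sided bounds to an approximate equilibrium *)

Local Open Scope ring_scope.

(** A difference [d] with [d <= k] satisfies [|d| <= 2k - d], and the differences sum to zero. *)
Lemma l1dist_le (R : realDomainType) (s k : nat) (x y : {ffun 'I_s -> nat}) :
  (\sum_l x l = \sum_l y l)%N -> (forall l, (x l <= y l + k)%N) ->
  l1dist R x y <= s%:R * (2 * k%:R).
Proof.
move=> xy xyk.
have -> : s%:R * (2 * k%:R) = \sum_(l < s) (2 * k%:R - ((x l)%:R - (y l)%:R)) :> R.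
  rewrite big_split /= sumrN sumrB -!natr_sum xy subrr subr0 sumr_const card_ord.
  by rewrite mulr_natl.
apply: ler_sum => l _; have : (x l)%:R <= (y l)%:R + k%:R :> R.
  by rewrite -natrD ler_nat.
have : 0 <= k%:R :> R by [].
by rewrite ler_norml; lra.
Qed.

Theorem theorem1 :
  exists C : rat, 0 < C /\
  forall (R : realFieldType) (n s : nat)
         (u : 'I_n -> 'I_s -> {ffun 'I_s -> nat} -> R) (lam : R),
    (2 <= n)%N -> (2 <= s)%N ->
    (forall p i x, inPi n x -> 0 <= u p i x <= 1) ->
    0 < lam ->
    (forall p i x y, inPi n x -> inPi n y ->
        `|u p i x - u p i y| <= lam * l1dist R x y) ->
    exists S : {ffun 'I_n -> 'I_s},
      approx_PNE u S (ratr C * (s%:R) ^+ 2 * lam).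
Proof.
(* The Lipschitz bound is used twice at distance [2s(s+3)], and [4s(s+3) <= 10s^2] for [s >= 2]. *)
exists 10; split=> // R n s u lam n2 s2 _ lam0 lip.
pose i0 := Ordinal (ltnW s2).
pose best p v := [arg max_(i > i0) u p i v]%O.
have bestP p v i : u p i v <= u p (best p v) v.
  by rewrite /best; case: arg_maxP => // j _; apply.
have [S SP] := view_le_others best (ltnW n2) s2.
exists S => p i; have [v [vPi Sp vo]] := SP p.
have oPi : inPi n (others S p) by rewrite /inPi sum_others.
have vdist : l1dist R v (others S p) <= s%:R * (2 * s.+3%:R).
  by apply: l1dist_le => //; rewrite sum_others; apply/eqP.
have lamdist := ler_wpM2l (ltW lam0) vdist.
have := lip p i _ _ vPi oPi; rewrite ler_norml => /andP[ui _].
have := lip p (S p) _ _ vPi oPi; rewrite ler_norml => /andP[_ uS].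
have := bestP p v i; rewrite -Sp => uv.
have : lam * (s%:R * (2 * s.+3%:R)) *+ 2 <= 10 * s%:R ^+ 2 * lam.
  rewrite [leRHS]mulrC -mulrnAr ler_pM2l //.
  rewrite -natrX -!natrM -mulr_natr -natrM ler_nat; nia.
rewrite ratr_nat; lra.
Qed.
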